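(* Let $\Gamma$ be an atomic graph and let $\varphi:\Gamma\to\Gamma^e$ be an embedding of $\Gamma$ into its extension graph as an induced (full) subgraph. Then there exist $g\in\mathbb{G}(\Gamma)$ and a graph automorphism $\alpha$ of $\Gamma$ such that $\varphi(\alpha(\Gamma))=\Gamma^g$, where $\Gamma^g$ is the induced subgraph of $\Gamma^e$ on the vertices $\{g^{-1}vg: v\in V(\Gamma)\}$; more precisely, up to conjugation by an element of $\mathbb{G}(\Gamma)$ and a graph automorphism of $\Gamma$, $\varphi$ is the standard inclusion $v\mapsto v$.
   Context: A finite simplicial graph is atomic if it is connected, has no vertices of valence $1$, has no cycles of length less than $5$, and the closed star of no vertex separates it. $\mathbb{G}(\Gamma)$ is the pc group (right-angled Artin group) with generators $V(\Gamma)$ and relations $[u,v]=1$ for each edge. The extension graph $\Gamma^e$ has vertex set $\{g^{-1}xg : x\in V(\Gamma), g\in\mathbb{G}(\Gamma)\}$, two distinct vertices being adjacent iff they commute in $\mathbb{G}(\Gamma)$. *)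

(* Defs.v *)
From mathcomp Require Import all_boot all_fingroup.
Set Implicit Arguments. Unset Strict Implicit. Unset Printing Implicit Defensive.

Definition simple_graph (T : finType) (e : rel T) : Prop :=
  symmetric e /\ irreflexive e.

Definition connected_graph (T : finType) (e : rel T) : Prop :=
  forall x y : T, connect e x y.

Definition no_valence_one (T : finType) (e : rel T) : Prop :=
  forall x : T, #|[set y | e x y]| != 1.

(* no cycles of length 3 or 4 (the only lengths < 5 in a simple graph) *)
Definition no_short_cycles (T : finType) (e : rel T) : Prop :=
  (forall a b c : T, ~ [/\ e a b, e b c & e c a]) /\
  (forall a b c d : T, a != c -> b != d -> ~ [/\ e a b, e b c, e c d & e d a]).

Definition closed_star (T : finType) (e : rel T) (v : T) : {set T} :=
  v |: [set y | e v y].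

Definition separates (T : finType) (e : rel T) (S : {set T}) : Prop :=
  exists x y : T, [/\ x \notin S, y \notin S &
    ~~ connect [rel a b | [&& e a b, a \notin S & b \notin S]] x y].

Definition atomic (T : finType) (e : rel T) : Prop :=
  [/\ connected_graph e, no_valence_one e, no_short_cycles e &
      forall v : T, ~ separates e (closed_star e v)].

(* ---- The right-angled Artin group G(Gamma) ----
   Elements are represented by words over the letters (v, true) = v and
   (v, false) = v^-1; raag_eq e is the congruence on words generated by free
   cancellation and by the commutation relations [u,v] = 1 for edges uv,
   i.e. two words are equal in G(Gamma) iff they are raag_eq-related. *)

Definition word (T : finType) := seq (T * bool).

Inductive raag_eq (T : finType) (e : rel T) : word T -> word T -> Prop :=
  | req_refl w : raag_eq e w w
  | req_sym w1 w2 : raag_eq e w1 w2 -> raag_eq e w2 w1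
  | req_trans w1 w2 w3 : raag_eq e w1 w2 -> raag_eq e w2 w3 -> raag_eq e w1 w3
  | req_cancel (u w : word T) (x : T) (b : bool) :
      raag_eq e (u ++ [:: (x, b); (x, ~~ b)] ++ w) (u ++ w)
  | req_comm (u w : word T) (x y : T) (b c : bool) : e x y ->
      raag_eq e (u ++ [:: (x, b); (y, c)] ++ w) (u ++ [:: (y, c); (x, b)] ++ w).

Definition winv (T : finType) (w : word T) : word T :=
  rev [seq (p.1, ~~ p.2) | p <- w].

Definition conj_gen (T : finType) (g : word T) (x : T) : word T :=
  winv g ++ [:: (x, true)] ++ g.

Definition ext_vertex (T : finType) (e : rel T) (w : word T) : Prop :=
  exists (g : word T) (x : T), raag_eq e w (conj_gen g x).

Definition commute_in (T : finType) (e : rel T) (p q : word T) : Prop :=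
  raag_eq e (p ++ q) (q ++ p).

Definition ext_adj (T : finType) (e : rel T) (p q : word T) : Prop :=
  ~ raag_eq e p q /\ commute_in e p q.

Definition induced_embedding (T : finType) (e : rel T) (phi : T -> word T) : Prop :=
  [/\ forall v, ext_vertex e (phi v),
      forall u v, raag_eq e (phi u) (phi v) -> u = v &
      forall u v, e u v <-> ext_adj e (phi u) (phi v)].

Definition graph_aut (T : finType) (e : rel T) (a : {perm T}) : Prop :=
  forall u v, e (a u) (a v) = e u v.

(* Main.v *)
(**
Write [G] for the group. A word for [g] is a gallery of conjugates of the defining
graph from the standard one to its conjugate by [g], each letter crossing a vertex
of the extension graph; counting crossings with sign gives integers [cr v g]. They
tell on which side of the star of [v] a conjugate of the graph (a "chamber") lies,
and yield centralisers, convexity (a finite set of vertices that is cut by no star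
lies in one chamber), and the absence of triangles and squares.

Let [f] be an embedding. A vertex [v] whose star cuts the image of [f] is not in the
image, by atomicity, and is the common neighbour of two vertices of the image; as
there are no squares, that pair determines [v]. By a ping-pong argument the
endomorphism [Phi] of [G] extending [f] is injective on the extension graph and
respects sides, so [Phi \o f] is again an embedding, with at least as many linked
pairs (pairs whose images have a common neighbour). Choose [f] with the most linked
pairs. In each chamber consider the piece of those vertices that lie in the image or
link a pair. Since [Phi \o f] links no new pair, [f] sends every piece into one
chamber. Applying [f] to a largest piece gives a chamber whose piece lies entirely in
the image, so no vertex of that chamber cuts, and the image of [f] is that chamber.
Hence the maximal number of linked pairs is the number of pairs at distance two, so
no embedding has a cutting vertex.
*)
From HB Require Import structures.
Require Import Defs.
From mathcomp Require Import all_boot all_fingroup.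
From mathcomp Require Import all_order all_algebra boolp zify.
Set Implicit Arguments. Unset Strict Implicit. Unset Printing Implicit Defensive.
Import Order.TTheory GRing.Theory Num.Theory.
Local Open Scope quotient_scope.
Local Open Scope group_scope.

(** * The group *)

Section WordCongruence.
Variables (T : finType) (e : rel T).
Implicit Types u v w : word T.

Lemma raag_eq_cat u w1 w2 v :
  raag_eq e w1 w2 -> raag_eq e (u ++ w1 ++ v) (u ++ w2 ++ v).
Proof.
elim=> {w1 w2} [w|w1 w2 _ IH|w1 w2 w3 _ IH1 _ IH2|u' w x b|u' w x y b c exy].
- exact: req_refl.
- exact: req_sym.
- exact: req_trans IH1 IH2.
- by rewrite -!catA !(catA u); exact: req_cancel.
- by rewrite -!catA !(catA u); exact: req_comm.
Qed.

Lemma raag_eq_cat2 w1 w2 v1 v2 :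
  raag_eq e w1 w2 -> raag_eq e v1 v2 -> raag_eq e (w1 ++ v1) (w2 ++ v2).
Proof.
move=> /(raag_eq_cat [::] v1) /= h1 /(raag_eq_cat w2 [::]).
by rewrite !cats0; exact: req_trans.
Qed.

Lemma winv_cat u v : winv (u ++ v) = winv v ++ winv u.
Proof. by rewrite /winv map_cat rev_cat. Qed.

Lemma winvK : involutive (@winv T).
Proof.
move=> w; rewrite /winv map_rev revK -map_comp.
by rewrite -[RHS]map_id; apply: eq_map => -[x b] /=; rewrite negbK.
Qed.

Lemma raag_eq_winv w1 w2 :
  raag_eq e w1 w2 -> raag_eq e (winv w1) (winv w2).
Proof.
elim=> {w1 w2} [w|w1 w2 _ IH|w1 w2 w3 _ IH1 _ IH2|u w x b|u w x y b c exy].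
- exact: req_refl.
- exact: req_sym.
- exact: req_trans IH1 IH2.
- rewrite !winv_cat -!catA.
  have -> : winv [:: (x, b); (x, ~~ b)] = [:: (x, b); (x, ~~ b)].
    by rewrite /winv /= negbK.
  exact: req_cancel.
- by rewrite !winv_cat -!catA; apply/req_sym/req_comm.
Qed.

Lemma raag_eq_winvr w : raag_eq e (w ++ winv w) [::].
Proof.
elim: w => [|[x b] w IH]; first exact: req_refl.
rewrite -cat1s winv_cat -catA (catA w).
apply: req_trans (raag_eq_cat [:: (x, b)] _ IH) _ => /=.
exact: (req_cancel e [::] [::] x b).
Qed.

Definition raag_eqb w1 w2 : bool := `[< raag_eq e w1 w2 >].

Lemma raag_eqb_refl : reflexive raag_eqb.
Proof. by move=> w; apply/asboolP; exact: req_refl. Qed.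

Lemma raag_eqb_sym : symmetric raag_eqb.
Proof. by move=> v w; apply/asboolP/asboolP; exact: req_sym. Qed.

Lemma raag_eqb_trans : transitive raag_eqb.
Proof.
by move=> v u w /asboolP h1 /asboolP h2; apply/asboolP; exact: req_trans h1 h2.
Qed.

Canonical raag_equiv := EquivRel raag_eqb raag_eqb_refl raag_eqb_sym raag_eqb_trans.

End WordCongruence.

Record sgraph (T : finType) := SGraph { sadj :> rel T; sadj_sym : symmetric sadj }.

Definition raag (T : finType) (e : sgraph T) : Type := {eq_quot (raag_equiv e)}.

HB.instance Definition _ (T : finType) (e : sgraph T) := Choice.on (raag e).

Section RaagGroup.
Variables (T : finType) (e : sgraph T).
Implicit Types w : word T.
Local Notation G := (raag e).

Definition cls w : G := \pi_({eq_quot (raag_equiv e)}) w.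
Definition wrd (g : G) : word T := generic_quotient.repr (g : {eq_quot (raag_equiv e)}).

Lemma wrdK : cancel wrd cls.
Proof. exact: generic_quotient.reprK. Qed.

Lemma cls_eqP w1 w2 : cls w1 = cls w2 <-> raag_eq e w1 w2.
Proof.
rewrite /cls; split=> [/eqP|h]; first by rewrite eqmodE => /asboolP.
by apply/eqP; rewrite eqmodE; apply/asboolP.
Qed.

Lemma wrd_cls w : raag_eq e (wrd (cls w)) w.
Proof. by apply/cls_eqP; rewrite wrdK. Qed.

Definition raag_mul (g h : G) : G := cls (wrd g ++ wrd h).
Definition raag_inv (g : G) : G := cls (winv (wrd g)).

Lemma raag_mul_cls w1 w2 : raag_mul (cls w1) (cls w2) = cls (w1 ++ w2).
Proof. by apply/cls_eqP/raag_eq_cat2; exact: wrd_cls. Qed.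

Lemma raag_inv_cls w : raag_inv (cls w) = cls (winv w).
Proof. exact/cls_eqP/raag_eq_winv/wrd_cls. Qed.

Lemma raag_mulA : associative raag_mul.
Proof.
by move=> g h k; rewrite -(wrdK g) -(wrdK h) -(wrdK k) !raag_mul_cls catA.
Qed.

Lemma raag_mul1 : left_id (cls [::]) raag_mul.
Proof. by move=> g; rewrite -(wrdK g) raag_mul_cls. Qed.

Lemma raag_mulr1 : right_id (cls [::]) raag_mul.
Proof. by move=> g; rewrite -(wrdK g) raag_mul_cls cats0. Qed.

Lemma raag_mulrV : right_inverse (cls [::]) raag_inv raag_mul.
Proof.
move=> g; rewrite -(wrdK g) raag_inv_cls raag_mul_cls.
exact/cls_eqP/raag_eq_winvr.
Qed.

Lemma raag_mulV : left_inverse (cls [::]) raag_inv raag_mul.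
Proof.
move=> g; rewrite -(wrdK g) raag_inv_cls raag_mul_cls -{2}[wrd g]winvK.
exact/cls_eqP/raag_eq_winvr.
Qed.

HB.instance Definition _ :=
  isGroup.Build G raag_mulA raag_mul1 raag_mulr1 raag_mulV raag_mulrV.

Lemma clsM w1 w2 : cls (w1 ++ w2) = cls w1 * cls w2.
Proof. by rewrite -raag_mul_cls. Qed.

Lemma clsV w : cls (winv w) = (cls w)^-1.
Proof. by rewrite -raag_inv_cls. Qed.

Lemma cls0 : cls [::] = 1.
Proof. by []. Qed.

Definition gen (x : T) : G := cls [:: (x, true)].
Definition ltr (l : T * bool) : G := if l.2 then gen l.1 else (gen l.1)^-1.

Lemma cls_cons l w : cls (l :: w) = ltr l * cls w.
Proof.
rewrite -cat1s clsM; congr (_ * _); case: l => x [] //=.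
by rewrite /ltr /= -clsV.
Qed.

Lemma cls_conj_gen w x : cls (conj_gen w x) = gen x ^ cls w.
Proof. by rewrite /conj_gen clsM clsM clsV. Qed.

Lemma ltrV x b : ltr (x, ~~ b) = (ltr (x, b))^-1.
Proof. by case: b; rewrite /ltr //= invgK. Qed.

Lemma gen_comm x y : e x y -> commute (gen x) (gen y).
Proof.
move=> exy; rewrite /commute /gen -!clsM.
by apply/cls_eqP; exact: (req_comm [::] [::] true true exy).
Qed.

Section Action.
Variables (S : Type) (st : T * bool -> S -> S).

(** Universal property of the group: a step map on letters compatible with cancellation and
    commutation gives an action. Exponent sums, crossing numbers and the endomorphism [Phi] all
    arise from choices of [st]. *)
Definition act (g : G) (s : S) : S := foldr st s (wrd g).

Hypothesis st_cancel : forall x b s, st (x, b) (st (x, ~~ b) s) = s.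
Hypothesis st_comm : forall x y b c s, e x y ->
  st (x, b) (st (y, c) s) = st (y, c) (st (x, b) s).

Lemma foldr_raag_eq w1 w2 : raag_eq e w1 w2 -> foldr st ^~ w1 =1 foldr st ^~ w2.
Proof.
elim=> {w1 w2} [w|w1 w2 _ IH|w1 w2 w3 _ IH1 _ IH2|u w x b|u w x y b c exy] s //.
- by rewrite IH1.
- by rewrite !foldr_cat /= st_cancel.
- by rewrite !foldr_cat /= st_comm.
Qed.

Lemma act_cls w s : act (cls w) s = foldr st s w.
Proof. exact/foldr_raag_eq/wrd_cls. Qed.

Lemma act1 s : act 1 s = s.
Proof. by rewrite -cls0 act_cls. Qed.

Lemma actM g h s : act (g * h) s = act g (act h s).
Proof. by rewrite -(wrdK g) -(wrdK h) -clsM !act_cls foldr_cat. Qed.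

Lemma act_ltr l s : act (ltr l) s = st l s.
Proof. by rewrite -(mulg1 (ltr l)) -cls0 -cls_cons act_cls. Qed.

Lemma act_gen x s : act (gen x) s = st (x, true) s.
Proof. by rewrite -[gen x]/(ltr (x, true)) act_ltr. Qed.

End Action.

Lemma raag_ind (P : G -> Prop) :
  P 1 -> (forall l g, P g -> P (ltr l * g)) -> forall g, P g.
Proof.
move=> P1 PM g; rewrite -(wrdK g); elim: (wrd g) => [|l w IH] //.
by rewrite cls_cons; exact: PM.
Qed.

End RaagGroup.

(** * Crossings and word length *)

Section Leastn.

Lemma ex_asbool (P : nat -> Prop) : (exists n, P n) -> exists n, `[< P n >].
Proof. by case=> n Pn; exists n; apply/asboolP. Qed.

(* Junk value [0] when no number satisfies [P]. *)
Definition leastn (P : nat -> Prop) : nat :=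
  if pselect (exists n, P n) is left H then ex_minn (ex_asbool H) else 0.

Lemma leastnP (P : nat -> Prop) : (exists n, P n) -> P (leastn P).
Proof.
rewrite /leastn; case: pselect => // H _.
by case: ex_minnP => m /asboolP.
Qed.

Lemma leastn_le (P : nat -> Prop) n : P n -> leastn P <= n.
Proof.
move=> Pn; rewrite /leastn; case: pselect => // H.
by case: ex_minnP => m _ /(_ n); apply; apply/asboolP.
Qed.

End Leastn.

Lemma pigeonhole (A : eqType) (s : seq A) (f : nat -> A) :
  (forall n, f n \in s) -> exists i j, i < j /\ f i = f j.
Proof.
move=> fs; have /(uniqPn (f 0)) : ~~ uniq (map f (iota 0 (size s).+1)).
  apply/negP => /uniq_leq_size le_s.
  have /le_s : {subset map f (iota 0 (size s).+1) <= s} by move=> _ /mapP[n _ ->].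
  by rewrite size_map size_iota ltnn.
case=> i [j [ltij]]; rewrite size_map size_iota => ltj.
rewrite !(nth_map 0) ?size_iota ?(ltn_trans ltij) // !nth_iota ?(ltn_trans ltij) //.
by exists i, j.
Qed.

Section Commuting.
Variable H : groupType.
Implicit Types x y z k : H.

Definition cmt x y : bool := x * y == y * x.

Lemma cmtP x y : reflect (commute x y) (cmt x y).
Proof. exact: eqP. Qed.

Lemma cmt_sym x y : cmt x y = cmt y x.
Proof. by rewrite /cmt eq_sym. Qed.

Lemma cmtxx x : cmt x x.
Proof. exact: eqxx. Qed.

Lemma cmtJ x y k : cmt (x ^ k) (y ^ k) = cmt x y.
Proof. by rewrite /cmt -!conjMg (inj_eq (@conjg_inj _ k)). Qed.

Lemma cmtM x y z : cmt x y -> cmt x z -> cmt x (y * z).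
Proof. by move=> /cmtP xy /cmtP xz; apply/cmtP/commuteM. Qed.

Lemma cmtV x y : cmt x y^-1 = cmt x y.
Proof.
by apply/cmtP/cmtP => [/commuteV|]; [rewrite invgK | exact: commuteV].
Qed.

Lemma cmtX x y n : cmt x y -> cmt x (y ^+ n).
Proof. by move=> /cmtP xy; apply/cmtP/commuteX. Qed.

Lemma cmt_conj x y : cmt x y -> x ^ y = x.
Proof. by move=> /cmtP/commgP/conjg_fixP. Qed.

Lemma conj_cmt x y : x ^ y = x -> cmt x y.
Proof. by move=> /conjg_fixP/commgP/cmtP. Qed.

Lemma cmtJl x y k : cmt y k -> cmt (x ^ k) y = cmt x y.
Proof. by move=> /cmt_conj yk; rewrite -{1}yk cmtJ. Qed.

End Commuting.

Definition sg (b : bool) : int := if b then 1%R else (-1)%R.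

Section Crossings.
Variables (T : finType) (e : sgraph T).
Local Notation G := (raag e).
Local Notation gen := (gen e).
Local Notation ltr := (ltr e).
Implicit Types (g h k v : G) (x u : T) (b : bool) (l : T * bool).

Lemma cmt_gen_ltr v x b : cmt v (ltr (x, b)) = cmt v (gen x).
Proof. by case: b; rewrite /ltr //= cmtV. Qed.

Lemma conj_gen_ltr x b : gen x ^ ltr (x, b) = gen x.
Proof. by apply: cmt_conj; rewrite cmt_gen_ltr cmtxx. Qed.

Lemma conj_ltr u b g : (ltr (u, b)) ^ g = if b then gen u ^ g else (gen u ^ g)^-1.
Proof. by case: b; rewrite /ltr //= conjVg. Qed.

Definition expo_step x l (n : int) : int :=
  if l.1 == x then (n + sg l.2)%R else n.

Lemma expo_step_cancel x y b n : expo_step x (y, b) (expo_step x (y, ~~ b) n) = n.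
Proof. by rewrite /expo_step /=; case: eqP => // _; case: b => /=; lia. Qed.

Lemma expo_step_comm x l l' n :
  expo_step x l (expo_step x l' n) = expo_step x l' (expo_step x l n).
Proof. by rewrite /expo_step; do 2?case: eqP => // _; lia. Qed.

Definition expo x g : int := act (expo_step x) g 0%R.

Let sK := expo_step_cancel.
Let sC x y z b c m (_ : e y z) := expo_step_comm x (y, b) (z, c) m.

Let expoA x g n : act (expo_step x) g n = (expo x g + n)%R.
Proof.
rewrite /expo; elim/raag_ind: g n => [|l g IH] n.
  by rewrite !(act1 (sK x) (sC x)) add0r.
rewrite !(actM (sK x) (sC x)) !(act_ltr (sK x) (sC x)) (IH n).
by rewrite /expo_step; case: ifP; lia.
Qed.

Lemma expoM x g h : expo x (g * h) = (expo x g + expo x h)%R.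
Proof. by rewrite {1}/expo (actM (sK x) (sC x)) expoA. Qed.

Lemma expo_gen x y : expo x (gen y) = (y == x)%:Z%R.
Proof.
by rewrite /expo (act_gen (sK x) (sC x)) /expo_step /=; case: eqP.
Qed.

(** Exponent sums are invariant under conjugation, so every vertex of the extension graph has a
    well-defined label in [T]. *)
Lemma gen_conj_inj x y g h : gen x ^ g = gen y ^ h -> x = y.
Proof.
have eC z k : expo x (z ^ k) = expo x z.
  have : expo x (k * z ^ k) = expo x (z * k) by rewrite -conjgC.
  rewrite !expoM; lia.
move=> /(congr1 (expo x)); rewrite !eC !expo_gen eqxx.
by case: eqP => // ->.
Qed.

Lemma gen_inj : injective gen.
Proof. by move=> x y exy; apply: (@gen_conj_inj x y 1 1); rewrite exy. Qed.

Definition flip_step x u l (n : int) : int :=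
  if l.1 == x then (n + sg l.2)%R else if l.1 == u then (- n)%R else n.

(* The group acts on the integers with [x] acting as a translation and [u] as a
   reflection, so that no positive power of [x] commutes with [u]. *)
Lemma cmt_gen_exp x u m : 0 < m -> cmt (gen u) (gen x ^+ m) -> u = x \/ e u x.
Proof.
move=> m_gt0; case: (eqVneq u x) => [|neq_ux]; first by left.
case: (boolP (e u x)) => [|not_eux]; [by right|move=> /cmtP cux; exfalso].
have fK y b n : flip_step x u (y, b) (flip_step x u (y, ~~ b) n) = n.
  by rewrite /flip_step /=; case: eqP => _; [case: b => /=; lia|case: eqP; lia].
have fC y z b c n : e y z ->
    flip_step x u (y, b) (flip_step x u (z, c) n) =
    flip_step x u (z, c) (flip_step x u (y, b) n).
  move=> eyz; rewrite /flip_step /=.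
  case: (eqVneq y x) => [yx|_]; case: (eqVneq z x) => [zx|_]; try lia.
    by case: eqP => // zu; move: eyz; rewrite yx zu sadj_sym (negPf not_eux).
    by case: eqP => // yu; move: eyz; rewrite yu zx (negPf not_eux).
  by do 2?case: eqP.
have actX n i : act (flip_step x u) (gen x ^+ i) n = (n + i%:Z)%R.
  elim: i => [|i IH]; first by rewrite expg0 (act1 fK fC); lia.
  by rewrite expgS (actM fK fC) IH (act_gen fK fC) /flip_step /= eqxx /=; lia.
have actu n : act (flip_step x u) (gen u) n = (- n)%R.
  by rewrite (act_gen fK fC) /flip_step /= (negPf neq_ux) eqxx.
have := congr1 (fun g => act (flip_step x u) g 0%R) cux.
rewrite /= !(actM fK fC) !actX !actu; lia.
Qed.

Lemma cmt_gen x u : cmt (gen u) (gen x) = (u == x) || e u x.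
Proof.
apply/idP/idP => [cux|/orP[/eqP->|/gen_comm/cmtP//]]; last exact: cmtxx.
by case: (@cmt_gen_exp x u 1) => // ->; rewrite ?eqxx ?orbT.
Qed.

Definition cross_step v l (p : G * int) : G * int :=
  (ltr l * p.1, (p.2 + if (gen l.1 ^ p.1)%g == v then sg l.2 else 0)%R).

Let kK v y b (p : G * int) : cross_step v (y, b) (cross_step v (y, ~~ b) p) = p.
Proof.
case: p => h n; rewrite /cross_step /= conjgM conj_gen_ltr ltrV mulVKg.
by congr (_, _); case: eqP => _; case: b => /=; lia.
Qed.

Let kC v y z b c (p : G * int) : e y z ->
  cross_step v (y, b) (cross_step v (z, c) p) =
  cross_step v (z, c) (cross_step v (y, b) p).
Proof.
case: p => h n eyz; rewrite /cross_step /= !conjgM.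
have cyz : cmt (gen y) (gen z) by rewrite cmt_gen eyz orbT.
rewrite (@cmt_conj _ (gen y)) ?cmt_gen_ltr // (@cmt_conj _ (gen z)); last first.
  by rewrite cmt_gen_ltr cmt_sym.
congr (_, _); last by rewrite -!addrA; congr (_ + _)%R; exact: addrC.
rewrite !mulgA; congr (_ * _); apply/cmtP.
by rewrite cmt_gen_ltr cmt_sym cmt_gen_ltr cmt_sym.
Qed.

(* [cr v g] is the signed number of times that a gallery of translates of the
   defining graph leading from [1] to [g] crosses the vertex [v] of the extension
   graph; [v] itself may be any element. *)
Definition cr v g : int := (act (cross_step v) g (1, 0%R)).2.

Let cross_fst v g : (act (cross_step v) g (1, 0%R)).1 = g.
Proof.
elim/raag_ind: g => [|l g IH]; first by rewrite (act1 (kK v) (@kC v)).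
by rewrite (actM (kK v) (@kC v)) (act_ltr (kK v) (@kC v)) /= IH.
Qed.

Lemma cr1 v : cr v 1 = 0%R.
Proof. by rewrite /cr (act1 (kK v) (@kC v)). Qed.

Lemma cr_ltrM v l g :
  cr v (ltr l * g) = (cr v g + if (gen l.1 ^ g)%g == v then sg l.2 else 0)%R.
Proof.
by rewrite /cr (actM (kK v) (@kC v)) (act_ltr (kK v) (@kC v)) /= cross_fst.
Qed.

(** Cocycle rule: the gallery to [g * h] runs along [h] first, then along the gallery of [g]
    translated by [h]; conjugating by [h^-1] undoes the translation. *)
Lemma crM v g h : cr v (g * h) = (cr v h + cr (v ^ h^-1)%g g)%R.
Proof.
elim/raag_ind: g => [|l g IH]; first by rewrite mul1g cr1 addr0.
rewrite -mulgA !cr_ltrM IH conjgM -(inj_eq (@conjg_inj _ h^-1)) conjgK.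
by rewrite addrA.
Qed.

Lemma crV v g : cr v g^-1 = (- cr (v ^ g)%g g)%R.
Proof. by have := crM v g g^-1; rewrite mulgV cr1 invgK; lia. Qed.

Lemma cr_ltr v l : cr v (ltr l) = (if gen l.1 == v then sg l.2 else 0)%R.
Proof. by rewrite -[ltr l]mulg1 cr_ltrM cr1 conjg1 add0r. Qed.

Lemma cr_gen v x : cr v (gen x) = (gen x == v)%:Z%R.
Proof. by rewrite -[gen x]/(ltr (x, true)) cr_ltr /=; case: eqP. Qed.

Lemma cr_genX v x i : v != gen x -> cr v (gen x ^+ i) = 0%R.
Proof.
move=> vx; elim: i => [|i IH]; first by rewrite expg0 cr1.
rewrite expgS -[gen x]/(ltr (x, true)) cr_ltrM IH /= cmt_conj ?cmtX ?cmtxx //.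
by rewrite eq_sym (negPf vx) addr0.
Qed.

Lemma cr_support g : exists s : seq G, forall v, cr v g != 0%R -> v \in s.
Proof.
elim/raag_ind: g => [|l g [s IH]]; first by exists [::] => v; rewrite cr1 eqxx.
exists (gen l.1 ^ g :: s) => v; rewrite cr_ltrM inE.
case: (eqVneq (gen l.1 ^ g) v) => //= _.
by rewrite addr0; exact: IH.
Qed.

Definition len g : nat := leastn (fun n => exists2 w, cls e w = g & size w = n).

Lemma len_word g : exists2 w, cls e w = g & size w = len g.
Proof.
apply: (@leastnP (fun n => exists2 w, cls e w = g & size w = n)).
by exists (size (wrd g)), (wrd g); rewrite ?wrdK.
Qed.

Lemma len_cls w : len (cls e w) <= size w.
Proof. by rewrite /len; apply: leastn_le; exists w. Qed.

Lemma len_eq0 g : len g = 0 -> g = 1.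
Proof. by have [w <- <-] := len_word g => /size0nil ->. Qed.

Lemma lenV g : len g^-1 = len g.
Proof.
suff le h : len h^-1 <= len h by apply/anti_leq; rewrite le -{1}[g]invgK le.
have [w <- <-] := len_word h; rewrite -clsV (leq_trans (len_cls _)) //.
by rewrite /winv size_rev size_map.
Qed.

Lemma cross_split b v w : (0 < sg b * cr v (cls e w))%R ->
  exists w1 x w2, w = w1 ++ (x, b) :: w2 /\ gen x ^ cls e w2 = v.
Proof.
elim: w => [|[x c] w IH]; first by rewrite cls0 cr1 mulr0 ltxx.
rewrite cls_cons cr_ltrM /=.
case: (ltP 0%R (sg b * cr v (cls e w))%R) => [/IH [w1 [y [w2 [-> vE]]]] _|].
  by exists ((x, c) :: w1), y, w2.
case: eqP => [vE|_]; last by lia.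
case: b c {IH} => [] [] /= le0 gt0; try (by exists [::], x, w).
all: by exfalso; move: le0 gt0; rewrite /sg; lia.
Qed.

(* The letter that crosses [gen u] can be moved to the right end of the word,
   because the letters after it multiply to an element fixing [gen u]. *)
Lemma len_descent u b k :
  (0 < sg b * cr (gen u) k)%R -> len (k * (ltr (u, b))^-1) < len k.
Proof.
have [w <- <-] := len_word k => /cross_split [w1 [x [w2 [-> xE]]]].
have xu : x = u by apply: (@gen_conj_inj x u (cls e w2) 1); rewrite conjg1.
rewrite {x}xu in xE *.
have /cmtP cuw : cmt (cls e w2) (ltr (u, b)).
  by rewrite cmt_gen_ltr cmt_sym; exact: conj_cmt.
rewrite clsM cls_cons -cuw mulgA mulgK -clsM.
by rewrite (leq_ltn_trans (len_cls _)) // !size_cat /= addnS.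
Qed.

(** Converse of [len_descent]: if the shorter element crossed [gen u] with the opposite sign,
    [len_descent] applied to it would make [k] shorter still. *)
Lemma descent_cr u b k :
  len (k * (ltr (u, b))^-1) < len k -> (0 < sg b * cr (gen u) k)%R.
Proof.
set k' := k * _ => ltk; have kE : k = k' * ltr (u, b) by rewrite mulgVK.
rewrite kE crM cr_ltr /= eqxx cmt_conj ?cmtV ?cmt_gen_ltr ?cmtxx //.
case: (ltP 0%R (sg (~~ b) * cr (gen u) k')%R) => [/len_descent|].
  by rewrite ltrV invgK -kE ltnNge (ltnW ltk).
by move: (cr _ k') => c; case: b {k' ltk kE} => /=; rewrite /sg; lia.
Qed.

Lemma len_gt0_descent k : 0 < len k ->
  exists u b, len (k * (ltr (u, b))^-1) < len k.
Proof.
have [w <- <-] := len_word k; case/lastP: w => // w [u b] _; exists u, b.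
rewrite -cats1 clsM cls_cons cls0 mulg1 mulgK size_cat addn1 ltnS.
exact: len_cls.
Qed.

Lemma len_gt0_descentl k : 0 < len k ->
  exists u b, len ((ltr (u, b))^-1 * k) < len k /\
    (0 < sg b * cr (gen u ^ k)%g k)%R.
Proof.
rewrite -lenV => /len_gt0_descent [u [b ltk]]; exists u, (~~ b); split.
  by rewrite ltrV invgK -(lenV (_ * k)) invgM.
have := descent_cr ltk; rewrite crV; case: b {ltk} => /=; rewrite /sg; lia.
Qed.

(** Centraliser theorem as an induction principle: what commutes with a positive power of [gen x] is
    a product of letters commuting with [gen x]. The proof strips the last letter of a shortest
    word. *)
Lemma cent_ind x (P : G -> Prop) : P 1 ->
  (forall k u b, cmt (gen u) (gen x) -> cmt k (gen x) -> P k -> P (k * ltr (u, b))) ->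
  forall k m, 0 < m -> cmt k (gen x ^+ m) -> cmt k (gen x) /\ P k.
Proof.
move=> P1 PM k m m_gt0.
have [n] := ubnP (len k); elim: n k => // n IH k lekn ckx.
case: (posnP (len k)) => [/len_eq0 ->|].
  by split=> //; rewrite cmt_sym; apply/cmtP/commute1.
move=> /len_gt0_descent [u [b ltk]].
have cu0 : cr (gen u) k != 0%R.
  by have := descent_cr ltk; apply: contraTneq => ->; rewrite mulr0 ltxx.
have cux : cmt (gen u) (gen x).
  case: (eqVneq u x) => [->|neq_ux]; first exact: cmtxx.
  (* Since [k] commutes with [X], it crosses all the [v j] equally often, and not zero times; only
     finitely many vertices are crossed, so two of the [v j] coincide. *)
  pose X := gen x ^+ m; pose v j := gen u ^ X ^+ j.
  have crX z j : cr (v j ^ z) X = 0%R.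
    apply: cr_genX; apply: contraNneq neq_ux; rewrite /v -conjgM -[gen x in RHS]conjg1.
    by move=> /gen_conj_inj ->.
  have crv j : cr (v j) k = cr (gen u) k.
    elim: j => [|j <-]; first by rewrite /v expg0 conjg1.
    have := congr1 (cr (v j.+1)) (cmtP _ _ ckx); rewrite !crM crX.
    rewrite -[X in cr X (gen x ^+ m)]conjg1 crX {1}/v expgSr conjgM conjgK.
    by rewrite add0r addr0.
  have [s sP] := cr_support k.
  have [|i [j [ltij vij]]] := @pigeonhole _ s v.
    by move=> j; apply: sP; rewrite crv.
  have /cmt_gen_exp : cmt (gen u) (gen x ^+ (m * (j - i))).
    apply: conj_cmt; apply: (@conjg_inj _ (X ^+ i)).
    by rewrite -conjgM expgnA -expgnDr subnK ?(ltnW ltij).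
  rewrite muln_gt0 m_gt0 subn_gt0 ltij => /(_ isT) [ux|eux].
    by rewrite ux eqxx in neq_ux.
  by rewrite cmt_gen eux orbT.
have {}ckx : cmt (k * (ltr (u, b))^-1) (gen x ^+ m).
  rewrite cmt_sym cmtM ?cmtV ?cmt_gen_ltr // cmt_sym //.
  exact: cmtX.
have [ck Pk] := IH _ (leq_trans ltk lekn) ckx.
rewrite -[k](mulgVK (ltr (u, b))); split; last exact: PM.
by rewrite cmt_sym cmtM ?cmt_gen_ltr // cmt_sym //.
Qed.
End Crossings.

(** * Chambers and sides *)

Section Chambers.
Variables (T : finType) (e : sgraph T).
Local Notation G := (raag e).
Local Notation gen := (gen e).
Local Notation ltr := (ltr e).
Implicit Types (g h k v y z : G) (x u : T) (b : bool).

(* [chamber g y]: the vertex [y] of the extension graph lies in the copy of the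
   defining graph conjugated by [g]. *)
Definition chamber g y : bool := [exists x, y == gen x ^ g].
Definition isV y : Prop := exists g, chamber g y.

Lemma chamberP g y : reflect (exists x, y = gen x ^ g) (chamber g y).
Proof. by apply: (iffP existsP) => -[x /eqP]; exists x => //; apply/eqP. Qed.

Lemma chamber_gen g x : chamber g (gen x ^ g).
Proof. by apply/chamberP; exists x. Qed.

Lemma isV_gen g x : isV (gen x ^ g).
Proof. by exists g; exact: chamber_gen. Qed.

Lemma isVP y : isV y <-> exists x g, y = gen x ^ g.
Proof.
by split=> [[g /chamberP[x ->]]|[x [g ->]]]; [exists x, g|exact: isV_gen].
Qed.

Lemma chamberJ g y k : chamber g y -> chamber (g * k) (y ^ k).
Proof. by move=> /chamberP[x ->]; rewrite -conjgM chamber_gen. Qed.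

Lemma isVJ y k : isV y -> isV (y ^ k).
Proof. by case=> g /(@chamberJ _ _ k) c; exists (g * k). Qed.

Lemma chamber_cmt g y k : cmt y k -> chamber g y -> chamber (g * k) y.
Proof. by move=> /cmt_conj {2}<-; exact: chamberJ. Qed.

Lemma chamber_ltr g y u b :
  cmt (gen u ^ g) y -> chamber g y -> chamber (ltr (u, b) * g) y.
Proof.
move=> cy; rewrite (conjgC (ltr _)); apply: chamber_cmt.
by rewrite conj_ltr; case: b; rewrite ?cmtV cmt_sym.
Qed.

Lemma cmt_root k y m : isV y -> 0 < m -> cmt k (y ^+ m) -> cmt k y.
Proof.
move=> /isVP[x [g ->]] m_gt0; rewrite -conjXg -[k](conjgKV g) !cmtJ => ck.
by case: (@cent_ind _ _ x (fun=> True) I _ _ _ m_gt0 ck).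
Qed.

(** By [cent_ind] the gallery of [k] can be kept in chambers containing [gen x], crossing only
    vertices that commute with [gen x]. *)
Lemma cr_cent k x v : cmt k (gen x) -> ~~ cmt v (gen x) -> cr v k = 0%R.
Proof.
move=> ck; pose P k := forall v, ~~ cmt v (gen x) -> cr v k = 0%R.
suff : P k by apply.
apply: (@cent_ind _ _ x P _ _ k 1 isT ck).2 => [|h u b cu _ IH] {}v cv.
  exact: cr1.
rewrite crM IH; last first.
  by rewrite cmtJl // cmtV cmt_gen_ltr cmt_sym.
rewrite cr_ltr /=; case: eqP => // uv; move: cv; rewrite -uv.
by rewrite cu.
Qed.

Lemma chamber2P g h y : chamber g y -> chamber h y ->
  exists x, y = gen x ^ g /\ cmt (h * g^-1) (gen x).
Proof.
move=> /chamberP[x ->] /chamberP[x' E]; exists x; split=> //.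
have xx' := gen_conj_inj E; rewrite -{}xx' in E.
by rewrite cmt_sym; apply: conj_cmt; rewrite conjgM -E conjgK.
Qed.

Lemma cr_chamber g h y v : chamber g y -> chamber h y -> ~~ cmt v y ->
  cr v h = cr v g.
Proof.
move=> cg ch; have [x [yE ck]] := chamber2P cg ch; rewrite {1}yE => cv.
rewrite -[h](mulgVK g) crM (cr_cent ck) ?addr0 //.
by rewrite -(cmtJ _ _ g) conjgKV.
Qed.

(* Junk value [1] when [y] is not a vertex of the extension graph. *)
Definition some_chamber y : G :=
  if pselect (isV y) is left H then xchoose H else 1.

Lemma some_chamberP y : isV y -> chamber (some_chamber y) y.
Proof. by rewrite /some_chamber; case: pselect => // H _; exact: (xchooseP H). Qed.

(* The component of the complement of the star of [v] in which [y] lies;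
   meaningful only when [y] does not commute with [v]. *)
Definition side v y : int := cr v (some_chamber y).

Lemma side_cr g y v : chamber g y -> ~~ cmt v y -> side v y = cr v g.
Proof.
move=> cg; apply: cr_chamber => //; apply: some_chamberP; by exists g.
Qed.

Lemma sideJ v y k : isV y -> ~~ cmt v y ->
  side (v ^ k) (y ^ k) = (side v y + cr (v ^ k)%g k)%R.
Proof.
case=> g cg cv; rewrite (side_cr (chamberJ k cg)) ?cmtJ // (side_cr cg cv).
by rewrite crM conjgK addrC.
Qed.

(* Otherwise the conjugates of [v] by all powers of [z] would separate a fixed
   pair of chambers. *)
Lemma side_cmt v y z : isV y -> isV z -> cmt y z -> ~~ cmt v y -> ~~ cmt v z ->
  side v y = side v z.
Proof.
move=> [g cg] Vz cyz nvy nvz; have [h ch] := Vz.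
rewrite (side_cr cg nvy) (side_cr ch nvz); apply/eqP/negPn/negP => neq.
(* Powers of [z] permute the chambers containing [y] and those containing [z], so every [a m]
   separates [g] from [h] by the same nonzero amount. *)
pose a m := v ^ (z ^+ m)^-1.
have am m : (cr (a m) g - cr (a m) h = cr v g - cr v h)%R.
  have <- : cr v (g * z ^+ m) = cr v g.
    by apply: cr_chamber nvy => //; apply: chamber_cmt cg; exact: cmtX.
  have <- : cr v (h * z ^+ m) = cr v h.
    by apply: cr_chamber nvz => //; apply: chamber_cmt ch; exact/cmtX/cmtxx.
  by rewrite !crM /a; lia.
have [s sP] := cr_support g; have [s' s'P] := cr_support h.
have [|i [j [ltij aij]]] := @pigeonhole _ (s ++ s') a.
  move=> m; rewrite mem_cat; apply/orP.
  case: (eqVneq (cr (a m) g) 0%R) => [g0|/sP]; last by left.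
  by right; apply: s'P; apply: contra neq => /eqP h0; move: (am m); rewrite g0 h0; lia.
move/negP: nvz; apply; apply: (@cmt_root v z (j - i)) => //; rewrite ?subn_gt0 //.
apply: conj_cmt; apply: (@conjg_inj _ (z ^+ j)^-1).
rewrite -[RHS]aij /a -conjgM; congr (_ ^ _).
by rewrite -[in z ^+ j](subnKC (ltnW ltij)) expgnDr invgM mulVKg.
Qed.

Definition dst g y : nat :=
  leastn (fun n => exists2 k, len k = n & chamber (k * g) y).

Lemma dst_attained g y : isV y -> exists2 k, len k = dst g y & chamber (k * g) y.
Proof.
case=> h ch; apply: (@leastnP (fun n => exists2 k, len k = n & chamber (k * g) y)).
by exists (len (h * g^-1)), (h * g^-1); rewrite ?mulgVK.
Qed.

Lemma dst_le g y k : chamber (k * g) y -> dst g y <= len k.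
Proof. by move=> c; rewrite /dst; apply: leastn_le; exists k. Qed.

(** [ltr (u, b) * g] is [g] times an element commuting with [y]; translating by it carries a nearest
    chamber to one that still contains [y]. *)
Lemma dst_cmt g y u b : isV y -> cmt (gen u ^ g) y ->
  dst (ltr (u, b) * g) y <= dst g y.
Proof.
move=> Vy cuy; have [k <- ck] := dst_attained g Vy.
apply: dst_le; rewrite (conjgC (ltr _)) mulgA; apply: chamber_cmt ck.
by rewrite conj_ltr; case: b; rewrite ?cmtV cmt_sym.
Qed.

Lemma dst_toward g y h u b : chamber h y -> ~~ cmt (gen u ^ g) y ->
  (0 < sg b * (cr (gen u ^ g)%g h - cr (gen u ^ g)%g g))%R ->
  dst (ltr (u, b) * g) y < dst g y.
Proof.
move=> ch nuy; have Vy : isV y by exists h.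
have [k <- ck] := dst_attained g Vy.
rewrite (cr_chamber ck ch nuy) crM conjgK addrAC subrr add0r => /len_descent.
by apply: leq_ltn_trans; apply: dst_le; rewrite mulgA mulgVK.
Qed.

(** The wall is the first vertex crossed by a shortest gallery from [g] to a chamber containing [y];
    if it commuted with [y], that crossing could be dropped. *)
Lemma near_wall g y : isV y -> ~~ chamber g y -> exists u b,
  [/\ ~~ cmt (gen u ^ g) y,
      (0 < sg b * (side (gen u ^ g)%g y - cr (gen u ^ g)%g g))%R &
      dst (ltr (u, b) * g) y < dst g y].
Proof.
move=> Vy ngy; have [k kd ck] := dst_attained g Vy.
have : 0 < len k.
  by rewrite lt0n; apply: contraNneq ngy => /len_eq0 k1; rewrite k1 mul1g in ck.
move=> /len_gt0_descent [u [b ltk]]; exists u, b.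
have nuy : ~~ cmt (gen u ^ g) y.
  apply: contraL ltk => cuy; rewrite -leqNgt kd; apply: dst_le.
  rewrite -ltrV -mulgA (conjgC (ltr _)) mulgA; apply: chamber_cmt ck.
  by rewrite conj_ltr; case: (~~ b); rewrite ?cmtV cmt_sym.
have pos : (0 < sg b * (side (gen u ^ g)%g y - cr (gen u ^ g)%g g))%R.
  rewrite (side_cr ck nuy) crM conjgK addrAC subrr add0r.
  exact: descent_cr.
split=> //; apply: dst_toward (some_chamberP Vy) nuy _.
exact: pos.
Qed.

(* A chamber minimising the total distance to the family contains all of it. *)
Lemma uncut_chamber (I : finType) (A : {set I}) (f : I -> G) :
  (forall i, i \in A -> isV (f i)) ->
  (forall v i j, isV v -> i \in A -> j \in A -> ~~ cmt v (f i) -> ~~ cmt v (f j) ->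
     side v (f i) = side v (f j)) ->
  exists g, forall i, i \in A -> chamber g (f i).
Proof.
move=> Vf uncut; pose D g := \sum_(i in A) dst g (f i).
pose P n := exists g, D g = n.
have [g Dg] : P (leastn P) by apply: leastnP; exists (D 1), 1.
exists g => i iA; apply: contraT => /(near_wall (Vf i iA)) [u [b [nui pos lt_i]]].
suff : D (ltr (u, b) * g) < D g.
  by rewrite Dg ltnNge leastn_le //; exists (ltr (u, b) * g).
rewrite /D (bigD1 i) //= [ltnRHS](bigD1 i) //= -addSn leq_add //.
apply: leq_sum => j /andP[jA _].
case: (boolP (cmt (gen u ^ g) (f j))) => [cuj|nuj]; first exact: dst_cmt (Vf j jA) cuj.
apply/ltnW/(dst_toward (some_chamberP (Vf j jA)) nuj).
by rewrite -/(side _ _) (uncut _ j i) //; exact: isV_gen.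
Qed.

Lemma cmt_chamber y z : isV y -> isV z -> cmt y z ->
  exists g, chamber g y /\ chamber g z.
Proof.
move=> Vy Vz cyz; pose f (b : bool) := if b then y else z.
have [||g gP] := @uncut_chamber bool setT f.
- by move=> [].
- move=> v [] [] _ _ _ //= nvy nvz; [|symmetry]; exact: side_cmt.
- by exists g; split; [apply: (gP true)|apply: (gP false)]; rewrite inE.
Qed.

(** Along a gallery from [y] to [z], each chamber is on the side of [v] where [y] lies or on the
    side of [y] where [v] lies: [v] is crossed only in chambers containing [v], and [y] only in
    chambers containing [y]. *)
Lemma otherside v y z : isV v -> isV y -> isV z ->
  ~~ cmt v y -> ~~ cmt z y -> side y z <> side y v ->
  ~~ cmt v z /\ side v z = side v y.
Proof.
move=> Vv Vy Vz nvy nzy neq; have nyv : ~~ cmt y v by rewrite cmt_sym.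
have nyz : ~~ cmt y z by rewrite cmt_sym.
have nvz : ~~ cmt v z.
  by apply/negP => cvz; apply: neq; apply: side_cmt => //; rewrite cmt_sym.
split=> //; have [h ch] := Vz; rewrite (side_cr ch nvz) in neq *.
rewrite (side_cr ch nyz) in neq.
suff [//|/neq//] : cr v h = side v y \/ cr y h = side y v.
have [g cg] := Vy; rewrite -(mulgVK g h); move: (h * g^-1) => k.
elim/raag_ind: k => [|[u b] k IH].
  by rewrite mul1g; left; rewrite (side_cr cg nvy).
rewrite -mulgA; set m := k * g in IH *; have cu := chamber_gen m u.
rewrite !cr_ltrM /=; case: eqP => [uv|_].
  right; rewrite uv in cu *; case: eqP => [vy|_]; first by rewrite vy cmtxx in nvy.
  by rewrite addr0 (side_cr cu nyv).
rewrite addr0; case: eqP => [uy|_]; last by rewrite addr0.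
by left; rewrite uy in cu; rewrite (side_cr cu nvy).
Qed.

Definition adj y z : bool := (y != z) && cmt y z.

Lemma adj_sym y z : adj y z = adj z y.
Proof. by rewrite /adj eq_sym cmt_sym. Qed.

Lemma adjJ y z k : adj (y ^ k) (z ^ k) = adj y z.
Proof. by rewrite /adj cmtJ (inj_eq (@conjg_inj _ k)). Qed.

Lemma adj_type x u g h : adj (gen x ^ g) (gen u ^ h) -> e x u.
Proof.
case/andP=> neq c.
have [k [/chamberP[x' E] /chamberP[u' E']]] :=
  cmt_chamber (isV_gen g x) (isV_gen h u) c.
have xx' := gen_conj_inj E; have uu' := gen_conj_inj E'.
rewrite -{}xx' in E; rewrite -{}uu' in E'.
move: c; rewrite E E' cmtJ cmt_gen => /orP[/eqP xu|//].
by move: neq; rewrite E E' xu eqxx.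
Qed.

(** * Girth of the extension graph *)

Section Girth.
Hypothesis no_short : no_short_cycles e.

Lemma adj_triangle_free y z v : isV y -> isV z -> isV v ->
  adj y z -> adj z v -> adj v y -> False.
Proof.
move=> /isVP[a [g ->]] /isVP[b [h ->]] /isVP[c [k ->]].
by move=> /adj_type ab /adj_type bc /adj_type ca; apply: no_short.1 (And3 ab bc ca).
Qed.

(* [gen u ^ h] is the first vertex separating the chambers containing [y] and [z] from
   those containing [y']. *)
Lemma square_retype y z y' z' x g g' : isV z -> isV z' ->
  y = gen x ^ g -> y' = gen x ^ g' -> y != y' ->
  adj y z -> adj z y' -> adj y' z' -> adj z' y ->
  exists u h, [/\ u != x, adj (gen u ^ h) z & adj (gen u ^ h) z'].
Proof.
move=> Vz Vz' yE y'E neq yz zy' y'z' z'y.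
have Vy : isV y by rewrite yE; exact: isV_gen.
have Vy' : isV y' by rewrite y'E; exact: isV_gen.
have [cyz czy' cy'z' cz'y] := And4 (andP yz).2 (andP zy').2 (andP y'z').2 (andP z'y).2.
pose P n := exists h, [/\ chamber h y, chamber h z & dst h y' = n].
have [h [hy hz hd]] : P (leastn P).
  have [h [hy hz]] := cmt_chamber Vy Vz cyz.
  by apply: leastnP; exists (dst h y'), h.
have nhy' : ~~ chamber h y'.
  apply: contraNN neq => /chamberP[x' E]; rewrite y'E in E.
  move: hy => /chamberP[x'' E']; rewrite yE in E'.
  by rewrite yE y'E E E' -(gen_conj_inj E) -(gen_conj_inj E').
have [u [b [nvy' pos lt_d]]] := near_wall Vy' nhy'.
set v := gen u ^ h in nvy' pos lt_d *; have Vv : isV v by exact: isV_gen.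
have sep t : isV t -> ~~ cmt v t -> cmt t y' -> side v t = cr v h -> False.
  move=> Vt nvt cty' st; move: pos; rewrite -st (side_cmt Vt Vy' cty' nvt nvy').
  by rewrite subrr mulr0 ltxx.
have cvz : cmt v z.
  by apply/negPn/negP => nvz; apply: (sep z) => //; exact: side_cr.
have avz : adj v z.
  by rewrite /adj cvz andbT; apply: contraNneq nvy' => ->.
have nvy : ~~ cmt v y.
  apply/negP => cvy; suff : dst (ltr (u, b) * h) y' >= dst h y' by rewrite leqNgt lt_d.
  rewrite hd; apply: leastn_le; exists (ltr (u, b) * h).
  by split=> //; exact: chamber_ltr.
have cvz' : cmt v z'.
  apply/negPn/negP => nvz'; apply: (sep z') => //; first by rewrite cmt_sym.
  by rewrite -(side_cr hy nvy); apply: side_cmt.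
exists u, h; split=> //.
  apply: contraNneq nvy => ux; move: hy => /chamberP[x' E].
  by rewrite /v ux E (_ : x = x') ?cmtxx //; apply: gen_conj_inj (etrans (esym yE) E).
by rewrite /adj cvz' andbT; apply: contraNneq nvy => vz'; rewrite /v vz'.
Qed.

(** If both pairs of opposite corners have distinct labels, the labels form a 4-cycle of the
    defining graph. Otherwise [square_retype] replaces a corner so that one more pair has distinct
    labels. *)
Lemma adj_square_free y z y' z' : isV y -> isV z -> isV y' -> isV z' ->
  y != y' -> z != z' -> adj y z -> adj z y' -> adj y' z' -> adj z' y -> False.
Proof.
have sq4 (a b c d : T) (g h k m : G) : a != c -> b != d ->
    adj (gen a ^ g) (gen b ^ h) -> adj (gen b ^ h) (gen c ^ k) ->
    adj (gen c ^ k) (gen d ^ m) -> adj (gen d ^ m) (gen a ^ g) -> False.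
  move=> ac bd /adj_type ab /adj_type bc /adj_type cd /adj_type da.
  exact: no_short.2 ac bd (And4 ab bc cd da).
have sq2 (a c : T) (g k w w' : G) : isV w -> isV w' -> a != c -> w != w' ->
    adj (gen a ^ g) w -> adj w (gen c ^ k) ->
    adj (gen c ^ k) w' -> adj w' (gen a ^ g) -> False.
  move=> /isVP[b [h wE]] /isVP[d [m w'E]] ac ww' aw wc cw' w'a.
  case: (eqVneq b d) => [bd|bd]; last first.
    by move: aw wc cw' w'a; rewrite wE w'E; exact: sq4.
  rewrite -bd in w'E.
  have [||||u [l [ub ua uc]]] := square_retype (isV_gen g a) (isV_gen k c) wE w'E ww'.
  1-4: by rewrite adj_sym.
  move: aw wc ua uc; rewrite wE => aw wc ua uc.
  by apply: (sq4 a b c u) aw wc _ ua => //; rewrite 1?eq_sym // adj_sym.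
move=> /isVP[a [g yE]] Vz /isVP[c [k y'E]] Vz' yy' zz' yz zy' y'z' z'y.
case: (eqVneq a c) => [ac|ac]; last first.
  by move: yz zy' y'z' z'y; rewrite yE y'E; exact: sq2.
rewrite -ac in y'E.
have [u [l [ux uz uz']]] := square_retype Vz Vz' yE y'E yy' yz zy' y'z' z'y.
move: yz z'y; rewrite yE => yz z'y.
by apply: (sq2 a u) Vz Vz' _ zz' yz _ uz' z'y; rewrite 1?eq_sym // adj_sym.
Qed.

End Girth.
End Chambers.

(** * Embeddings and their extensions *)

Lemma connect_const (T : finType) (A : Type) (r : rel T) (F : T -> A) x y :
  (forall a b, r a b -> F a = F b) -> connect r x y -> F x = F y.
Proof.
move=> Fr /connectP[p]; elim: p x => [|z p IH] x /=; first by move=> _ ->.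
by case/andP=> /Fr -> rp yE; exact: IH.
Qed.

Section Embeddings.
Variables (T : finType) (e : sgraph T).
Local Notation G := (raag e).
Local Notation gen := (gen e).
Local Notation ltr := (ltr e).
Implicit Types (g h k v : G) (x u : T).

Definition embedding (f : T -> G) : Prop :=
  [/\ forall x, isV (f x), injective f &
      forall x y, cmt (f x) (f y) = (x == y) || e x y].

Lemma embedding_adj f x y : irreflexive e -> embedding f -> adj (f x) (f y) = e x y.
Proof.
move=> e_irr [_ f_inj f_cmt]; rewrite /adj f_cmt (inj_eq f_inj).
by case: eqP => [->|] //=; rewrite e_irr.
Qed.

(** * Vertices that cut an embedding *)

Section Cuts.
Hypothesis e_atomic : atomic e.

(** The complement of the closed star of [u] is connected by atomicity, and by [side_cmt] the side
    is constant along its edges. *)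
Lemma same_side f u x y : embedding f -> ~~ cmt (f u) (f x) -> ~~ cmt (f u) (f y) ->
  side (f u) (f x) = side (f u) (f y).
Proof.
move=> [Vf _ f_cmt] nx ny.
have starP z : (z \notin closed_star e u) = ~~ cmt (f u) (f z).
  by rewrite /closed_star !inE f_cmt [u == z]eq_sym.
case: e_atomic => _ _ _ /(_ u) nsep.
have [|ncon] := boolP (connect [rel a b | [&& e a b, a \notin closed_star e u
                                            & b \notin closed_star e u]] x y).
  apply: (connect_const (F := fun z => side (f u) (f z))) => a b /= /and3P[eab].
  rewrite !starP; apply: side_cmt => //.
  by rewrite f_cmt eab orbT.
by case: nsep; exists x, y; rewrite !starP.
Qed.

Section Cut.
Variables (f : T -> G) (v : G) (x y : T).
Hypotheses (f_emb : embedding f) (nx : ~~ cmt v (f x)) (ny : ~~ cmt v (f y)).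
Hypothesis neq : side v (f x) <> side v (f y).

Lemma cut_notin u : v <> f u.
Proof.
by move=> vE; move: nx ny neq; rewrite vE => nx' ny'; case; exact: same_side.
Qed.

(* A single vertex [s] commuting with [v] cannot separate: every neighbour of [s]
   has a further neighbour, which lies outside the star of [s]. *)
Lemma cut_nbrs : exists s t, [/\ s != t, cmt v (f s) & cmt v (f t)].
Proof.
have [Vf _ f_cmt] := f_emb; have [e_conn e_val [e_tri _] e_sep] := e_atomic.
have step a b : e a b -> ~~ cmt v (f a) -> ~~ cmt v (f b) ->
    side v (f a) = side v (f b).
  by move=> eab; apply: side_cmt => //; rewrite f_cmt eab orbT.
apply: contrapT => no2; apply: neq.
have [[s cs]|none] := pselect (exists s, cmt v (f s)); last first.
  apply: (connect_const (F := fun z => side v (f z)) _ (e_conn x y)) => a b eab.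
  by apply: step => //; apply/negP => c; apply: none; [exists a|exists b].
have only a : a != s -> ~~ cmt v (f a).
  by move=> neq_as; apply/negP => ca; apply: no2; exists a, s.
have out a b : a \notin closed_star e s -> b \notin closed_star e s ->
    side v (f a) = side v (f b).
  move=> na nb; apply: (connect_const (F := fun z => side v (f z))
    (r := [rel a b | [&& e a b, a \notin closed_star e s & b \notin closed_star e s]])).
    move=> c d /= /and3P[ecd]; rewrite !inE !negb_or => /andP[nc _] /andP[nd _].
    by apply: step ecd _ _; exact: only.
  by apply/negPn/negP => ncon; apply: (e_sep s); exists a, b.
have far a : a != s ->
    exists2 c, c \notin closed_star e s & side v (f a) = side v (f c).
  move=> neq_as; have [esa|nesa] := boolP (e s a); last first.
    by exists a => //; rewrite !inE negb_or neq_as.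
  have /card_gt1P [c [d [ac ad neq_cd]]] : 1 < #|[set c | e a c]|.
    rewrite ltn_neqAle eq_sym e_val; apply/card_gt0P; exists s.
    by rewrite inE sadj_sym.
  wlog nec : c d ac ad neq_cd / c != s.
    move=> W; case: (eqVneq c s) => [cs'|]; last by apply: W ad _.
    by apply: (W d c) => //; rewrite eq_sym // -cs'.
  rewrite inE in ac; exists c; last by apply: step => //; exact: only.
  rewrite !inE negb_or nec /=; apply/negP => esc.
  by apply: (e_tri s a c); split=> //; rewrite sadj_sym.
have xs : x != s by apply: contraNneq nx => ->.
have ys : y != s by apply: contraNneq ny => ->.
have [c nc ->] := far x xs; have [d nd ->] := far y ys; exact: out.
Qed.

End Cut.
End Cuts.

(** * The endomorphism extending an embedding *)

Section Extension.
Variable f : T -> G.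
Hypothesis f_emb : embedding f.

Let Vf x : isV (f x). Proof. by case: f_emb. Qed.
Let f_inj : injective f. Proof. by case: f_emb. Qed.
Let f_cmt x y : cmt (f x) (f y) = (x == y) || e x y. Proof. by case: f_emb. Qed.

Definition subst_step (l : T * bool) h : G :=
  (if l.2 then f l.1 else (f l.1)^-1) * h.

Let sK x b h : subst_step (x, b) (subst_step (x, ~~ b) h) = h.
Proof. by case: b; rewrite /subst_step /= ?mulKg ?mulVKg. Qed.

Let sC x y b c h : e x y ->
  subst_step (x, b) (subst_step (y, c) h) = subst_step (y, c) (subst_step (x, b) h).
Proof.
move=> exy; rewrite /subst_step /= !mulgA; congr (_ * _); apply/cmtP.
have cxy : cmt (f x) (f y) by rewrite f_cmt exy orbT.
by case: b c => [] []; rewrite ?cmtV // cmt_sym ?cmtV // cmt_sym.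
Qed.

Definition Phi g : G := act subst_step g 1.

Let PhiA g h : act subst_step g h = Phi g * h.
Proof.
rewrite /Phi; elim/raag_ind: g h => [|l g IH] h; first by rewrite !(act1 sK sC) mul1g.
by rewrite !(actM sK sC) IH !(act_ltr sK sC) /subst_step mulgA.
Qed.

Lemma Phi1 : Phi 1 = 1.
Proof. by rewrite /Phi (act1 sK sC). Qed.

Lemma PhiM g h : Phi (g * h) = Phi g * Phi h.
Proof. by rewrite {1}/Phi (actM sK sC) PhiA. Qed.

Lemma PhiV g : Phi g^-1 = (Phi g)^-1.
Proof. by apply: (@mulgI _ (Phi g)); rewrite -PhiM !mulgV Phi1. Qed.

Lemma PhiJ g h : Phi (g ^ h) = Phi g ^ Phi h.
Proof. by rewrite !conjgE !PhiM PhiV. Qed.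

Lemma Phi_gen x : Phi (gen x) = f x.
Proof. by rewrite /Phi (act_gen sK sC) /subst_step /= mulg1. Qed.

Lemma Phi_ltr u b : Phi (ltr (u, b)) = if b then f u else (f u)^-1.
Proof. by case: b; rewrite /ltr /= ?PhiV Phi_gen. Qed.

Lemma Phi_vertex x g : Phi (gen x ^ g) = f x ^ Phi g.
Proof. by rewrite PhiJ Phi_gen. Qed.

Lemma isV_Phi y : isV y -> isV (Phi y).
Proof. by move=> /isVP[x [g ->]]; rewrite Phi_vertex; exact: isVJ. Qed.

Lemma cmt_Phi g h : cmt g h -> cmt (Phi g) (Phi h).
Proof. by move=> /eqP E; apply/eqP; rewrite -!PhiM E. Qed.

Lemma Phi_cmt_inj y z : isV y -> isV z -> cmt y z -> Phi y = Phi z -> y = z.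
Proof.
move=> Vy Vz /(cmt_chamber Vy Vz) [g [/chamberP[x ->] /chamberP[u ->]]].
by rewrite !Phi_vertex => /conjg_inj/f_inj ->.
Qed.

(** The gallery to [y = gen x ^ h] follows [h], crosses [y], and returns along the translate by [y]
    of the same path; when [v] commutes with [y] the two legs cancel. *)
Lemma cr_vertex v y : isV y -> cmt v y -> cr v y = (v == y)%:Z%R.
Proof.
move=> /isVP[x [h ->]] c; rewrite {1}conjgE !crM crV cr_gen.
have -> : (v ^ (gen x * h)^-1) ^ h = v.
  by rewrite -conjgM invgM -mulgA -conjgE conjVg cmt_conj // cmtV.
have -> : (gen x == v ^ h^-1) = (v == gen x ^ h).
  by rewrite -(inj_eq (@conjg_inj _ h)) conjgKV eq_sym.
by lia.
Qed.

(** On the centraliser of [gen x] both numbers are additive and count the letters [x] with sign. *)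
Lemma cr_Phi_cent x k : cmt k (gen x) -> cr (f x) (Phi k) = cr (gen x) k.
Proof.
move=> ck; pose P k := cr (f x) (Phi k) = cr (gen x) k.
apply: (@cent_ind _ _ x P _ _ k 1 isT ck).2 => [|h u b cu _]; rewrite /P.
  by rewrite Phi1 !cr1.
move=> IH; have cfu : cmt (f x) (f u) by rewrite f_cmt -cmt_gen cmt_sym.
rewrite PhiM !crM Phi_ltr cr_ltr /=.
rewrite [gen x ^ _]cmt_conj ?cmtV ?cmt_gen_ltr 1?cmt_sym //.
rewrite [f x ^ _]cmt_conj; last by case: b; rewrite ?invgK ?cmtV.
rewrite IH; congr (_ + _)%R; rewrite (inj_eq (@gen_inj _ _)).
case: b; rewrite ?crV ?(cmt_conj cfu) cr_vertex // (inj_eq f_inj) eq_sym.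
all: by case: eqP.
Qed.

Section PingPong.
Hypothesis e_atomic : atomic e.

(** Here [c] is the offset between the sides of [Phi v] and those of [v], tested only on vertices
    sharing a chamber with [v]. *)
Definition calibrated v (c : int) : Prop := forall g (z : G),
  chamber g v -> chamber g z -> ~~ cmt v z ->
  ~~ cmt (Phi v) (Phi z) /\ side (Phi v) (Phi z) = (c + cr v g)%R.

(** [same_side] yields the constant for one chamber containing [v]; the others differ from it by
    centralising elements, to which [cr_Phi_cent] applies. *)
Lemma ex_calibrated v : isV v -> exists c, calibrated v c.
Proof.
move=> /isVP[x [h vE]].
have [c0 c0P] : exists c0, forall w, ~~ cmt (f x) (f w) -> side (f x) (f w) = c0.
  have [[w nw]|none] := pselect (exists w, ~~ cmt (f x) (f w)).
    by exists (side (f x) (f w)) => w' nw'; exact: same_side.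
  by exists 0%R => w nw; case: none; exists w.
exists (c0 + cr (Phi v) (Phi h) - cr v h)%R => g z gv /chamberP[w ->] {z} nvw.
have ch : chamber h v by rewrite vE; exact: chamber_gen.
have [x' [vE' ck]] := chamber2P ch gv.
have xx' : x = x' by apply: gen_conj_inj (etrans (esym vE) vE').
rewrite -xx' in ck.
have gE : g = (g * h^-1) * h by rewrite mulgVK.
have vg : v = gen x ^ g.
  by rewrite gE conjgM (cmt_conj (_ : cmt (gen x) _)) // cmt_sym.
have nxw : ~~ cmt (f x) (f w) by move: nvw; rewrite vg cmtJ cmt_gen f_cmt.
rewrite {1 2}vg !Phi_vertex cmtJ; split=> //.
rewrite sideJ // c0P // -Phi_vertex -vg {1}gE PhiM crM.
have -> : Phi v ^ (Phi h)^-1 = f x by rewrite vE Phi_vertex conjgK.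
rewrite cr_Phi_cent // [in RHS]gE (crM v _ h).
have -> : v ^ h^-1 = gen x by rewrite vE conjgK.
by lia.
Qed.

(* If [y], the last vertex crossed on the way from [v] to [z], does not commute
   with [v], then [Phi y] separates [Phi v] from [Phi z]. *)
Lemma ping_pong v (z : G) c : isV v -> isV z -> calibrated v c -> ~~ cmt v z ->
  ~~ cmt (Phi v) (Phi z) /\ side (Phi v) (Phi z) = (c + side v z)%R.
Proof.
move=> Vv Vz; have [g0 g0v] := Vv; have [h hz] := Vz.
move: hz; rewrite -[h](mulgVK g0); move: (h * g0^-1) => k {h}.
have [n] := ubnP (len k); elim: n k v z c g0 g0v Vv Vz => // n IH k v z c g0 g0v Vv Vz.
rewrite ltnS => lekn kz cal nvz.
case: (posnP (len k)) => [/len_eq0 k1|].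
  rewrite k1 mul1g in kz; rewrite (side_cr kz nvz); exact: cal.
move=> /len_gt0_descentl [u [b [ltk pos]]].
set k' := _ * k in ltk; have {}lekn := leq_trans ltk lekn.
have k'E : k = ltr (u, b) * k' by rewrite mulVKg.
set g := k * g0 in kz *; set y := gen u ^ g.
have gy : chamber g y by exact: chamber_gen.
have Vy : isV y by exact: isV_gen.
pose yb := if b then y else y^-1.
have cyb (w : G) : cmt w yb = cmt w y by rewrite /yb; case: (b); rewrite ?cmtV.
have gE : g = k' * g0 * yb.
  have -> : yb = ltr (u, b) ^ (k' * g0).
    rewrite /yb /y -conj_ltr /g k'E -mulgA conjgM.
    by rewrite [ltr _ ^ ltr _]cmt_conj // cmtxx.
  by rewrite -conjgC mulgA -k'E.
have g'E : k' * g0 = g * yb^-1 by rewrite gE mulgK.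
have g'y : chamber (k' * g0) y.
  by rewrite g'E; apply: chamber_cmt gy; rewrite cmtV cyb cmtxx.
have [czy|nzy] := boolP (cmt z y).
  apply: (IH k' v z c g0) => //; rewrite g'E; apply: chamber_cmt kz.
  by rewrite cmtV cyb.
(* If [v] commutes with [y], conjugation by [yb^-1] fixes [v] and removes the last crossing; both
   sides shift equally, and only when [v = y]. *)
have [cvy|nvy] := boolP (cmt v y).
  have vyb : v ^ yb = v by apply: cmt_conj; rewrite cyb.
  have Vyb : Phi v ^ Phi yb = Phi v by rewrite -PhiJ vyb.
  have zE : z = (z ^ yb^-1) ^ yb by rewrite conjgKV.
  have Vz' : isV (z ^ yb^-1) by exact: isVJ.
  have nvz' : ~~ cmt v (z ^ yb^-1) by rewrite -(cmtJ _ _ yb) conjgKV vyb.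
  have [] := IH k' v (z ^ yb^-1) c g0 => //; first by rewrite g'E; exact: chamberJ.
  move=> nV sV.
  have nVz : ~~ cmt (Phi v) (Phi z) by rewrite -Vyb zE PhiJ cmtJ.
  split=> //.
  have -> : side v z = (side v (z ^ yb^-1)%g + cr v yb)%R.
    by rewrite -{1}vyb {1}zE sideJ // vyb.
  have -> : side (Phi v) (Phi z) =
      (side (Phi v) (Phi (z ^ yb^-1)%g) + cr (Phi v) (Phi yb))%R.
    by rewrite -{1}Vyb {1}zE PhiJ sideJ ?Vyb //; exact: isV_Phi.
  rewrite sV -addrA; congr (_ + (_ + _))%R.
  have eqV : (Phi v == Phi y) = (v == y).
    by apply/eqP/eqP => [/(Phi_cmt_inj Vv Vy cvy)|->].
  have cVy := cmt_Phi cvy; have VPy := isV_Phi Vy.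
  rewrite /yb; case: (b).
    by rewrite !cr_vertex // eqV.
  by rewrite PhiV !crV (cmt_conj cvy) (cmt_conj cVy) !cr_vertex // eqV.
have nyv : ~~ cmt y v by rewrite cmt_sym.
have nyz : ~~ cmt y z by rewrite cmt_sym.
have [nVY sVY] := IH k' v y c g0 g0v Vv Vy lekn g'y cal nvy.
have [c' cal'] := ex_calibrated Vy.
have [nYV sYV] : ~~ cmt (Phi y) (Phi v) /\ side (Phi y) (Phi v) = (c' + side y v)%R.
  by apply: (IH k'^-1 y v c' (k' * g0)) => //; rewrite ?lenV ?mulKg.
have [nYZ sYZ] := cal' g z gy kz nyz.
have [||nVZ ->] := otherside (isV_Phi Vv) (isV_Phi Vy) (isV_Phi Vz) nVY.
- by rewrite cmt_sym.
- rewrite sYV sYZ (side_cr g0v nyv) /g crM.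
  have -> : y ^ g0^-1 = gen u ^ k by rewrite /y /g conjgM conjgK.
  move=> /addrI /eqP; rewrite -subr_eq0 addrAC subrr add0r => /eqP cr0.
  by move: pos; rewrite cr0 mulr0 ltxx.
- by split=> //; rewrite sVY (side_cr gy nvy) (side_cr kz nvz).
Qed.

Lemma Phi_cmt v (z : G) : isV v -> isV z -> cmt (Phi v) (Phi z) = cmt v z.
Proof.
move=> Vv Vz; apply/idP/idP; last exact: cmt_Phi.
apply: contraTT => nvz; have [c cal] := ex_calibrated Vv.
by have [] := ping_pong Vv Vz cal nvz.
Qed.

Lemma Phi_inj v (z : G) : isV v -> isV z -> Phi v = Phi z -> v = z.
Proof.
move=> Vv Vz E; have cvz : cmt v z by rewrite -Phi_cmt // E cmtxx.
exact: Phi_cmt_inj E.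
Qed.

Lemma Phi_adj v (z : G) : isV v -> isV z -> adj (Phi v) (Phi z) = adj v z.
Proof.
move=> Vv Vz; rewrite /adj Phi_cmt //; congr (~~ _ && _).
by apply/eqP/eqP => [/(Phi_inj Vv Vz)|->].
Qed.

Lemma Phi_embedding : embedding (Phi \o f).
Proof.
split=> [x|x y /= /Phi_inj E|x y] /=; first exact: isV_Phi.
  by apply: f_inj; apply: E.
by rewrite Phi_cmt.
Qed.

End PingPong.
End Extension.
End Embeddings.

(** * Rigidity *)

Section Rigidity.
Variables (T : finType) (e : sgraph T).
Local Notation G := (raag e).
Local Notation gen := (gen e).
Local Notation ltr := (ltr e).
Implicit Types (f : T -> G) (g h w : G) (x y s t : T).
Hypotheses (e_irr : irreflexive e) (e_atomic : atomic e).

Let no_short : no_short_cycles e. Proof. by case: e_atomic. Qed.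

Definition linked f : {set T * T} := [set p | (p.1 != p.2) &&
  `[< exists w, [/\ isV w, adj w (f p.1) & adj w (f p.2)] >]].

Lemma linkedP f s t : reflect
  (s != t /\ exists w, [/\ isV w, adj w (f s) & adj w (f t)]) ((s, t) \in linked f).
Proof.
rewrite inE /=; apply: (iffP andP) => -[st].
  by move=> /asboolP; split.
by move=> ex; split=> //; apply/asboolP.
Qed.

Lemma linked_Phi f : embedding f -> linked f \subset linked (Phi f \o f).
Proof.
move=> f_emb; have [Vf _ _] := f_emb.
apply/subsetP => -[s t] /linkedP[st [w [Vw ws wt]]].
apply/linkedP; split=> //; exists (Phi f w); split; first exact: isV_Phi.
all: by rewrite /= Phi_adj.
Qed.

Lemma embedding_perm f g : embedding f -> (forall x, chamber g (f x)) ->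
  exists a : {perm T}, (forall x, f x = gen (a x) ^ g) /\ graph_aut e a.
Proof.
move=> f_emb fg; have [_ f_inj _] := f_emb.
have /fin_all_exists [a aP] x : exists u, f x = gen u ^ g by apply/chamberP.
have a_inj : injective a by move=> x y axy; apply: f_inj; rewrite !aP axy.
exists (perm a_inj); split=> [x|x y]; first by rewrite permE.
rewrite !permE -[RHS](embedding_adj x y e_irr f_emb) !aP adjJ /adj cmt_gen.
by rewrite (inj_eq (@gen_inj _ _)); case: eqP => [->|] //=; rewrite e_irr.
Qed.

(** Without triangles no closed star contains such a path, and adjacency-preserving injections carry
    such paths along. *)
Definition path4 (A : {set T}) : Prop := exists a b c d,
  [/\ [set a; b; c; d] \subset A, e a b, e b c, e c d & (a != c) && (b != d)].

(** * Embeddings with the most linked pairs *)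

Section Maximal.
Variable f : T -> G.
Hypothesis f_emb : embedding f.
Hypothesis f_max : forall f', embedding f' -> #|linked f'| <= #|linked f|.

Let Vf x : isV (f x). Proof. by case: f_emb. Qed.
Let f_inj : injective f. Proof. by case: f_emb. Qed.
Let f_adj x y : adj (f x) (f y) = e x y. Proof. exact: embedding_adj. Qed.

Definition hull w : Prop := (exists x, w = f x) \/
  (exists s t, [/\ s != t, isV w, adj w (f s) & adj w (f t)]).

Definition piece g : {set T} := [set x | `[< hull (gen x ^ g) >]].
Definition core g : {set T} := [set x | [exists s, gen x ^ g == f s]].

Lemma pieceP g x : reflect (hull (gen x ^ g)) (x \in piece g).
Proof. by rewrite inE; exact: asboolP. Qed.

Lemma coreP g x : reflect (exists s, gen x ^ g = f s) (x \in core g).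
Proof.
by rewrite inE; apply: (iffP existsP) => -[s /eqP]; exists s => //; apply/eqP.
Qed.

Lemma core_piece g : core g \subset piece g.
Proof. by apply/subsetP => x /coreP ?; apply/pieceP; left. Qed.

(* A vertex cutting [f (piece g)] would link a new pair for [Phi f \o f]. *)
Lemma piece_uncut g w x y : isV w -> x \in piece g -> y \in piece g ->
  ~~ cmt w (f x) -> ~~ cmt w (f y) -> side w (f x) = side w (f y).
Proof.
move=> Vw xp yp nx ny; apply: contrapT => neq.
pose W := w ^ Phi f g; have VW : isV W by exact: isVJ.
have pX z : ~~ cmt w (f z) -> ~~ cmt W (Phi f (gen z ^ g)) /\
    side W (Phi f (gen z ^ g)) = (side w (f z) + cr W (Phi f g))%R.
  by move=> nz; rewrite Phi_vertex // cmtJ sideJ.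
have [nX sX] := pX x nx; have [nY sY] := pX y ny.
have {}neq : side W (Phi f (gen x ^ g)) <> side W (Phi f (gen y ^ g)).
  by rewrite sX sY => /addIr.
(* By [ping_pong], [Phi f w0] has the images of chamber [g] off its star on a single side, whereas
   [W] separates two of them. *)
have notPhi w0 : isV w0 -> W <> Phi f w0.
  move=> V0 WE; have [c cal] := ex_calibrated f_emb e_atomic V0.
  have lev z : ~~ cmt W (Phi f (gen z ^ g)) ->
      side W (Phi f (gen z ^ g)) = (c + cr w0 g)%R.
    rewrite WE Phi_cmt //; last exact: isV_gen.
    move=> n0; have [_ ->] := ping_pong f_emb e_atomic V0 (isV_gen _ _) cal n0.
    by rewrite (side_cr (chamber_gen g z) n0).
  by apply: neq; rewrite !lev.
(* If both ends of a pair linked by [gen z ^ g] went into the star of [W], they would form a square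
   with [W] and [Phi f (gen z ^ g)]. *)
have rep z : z \in piece g -> ~~ cmt W (Phi f (gen z ^ g)) ->
    exists2 s, ~~ cmt W (Phi f (f s)) &
      side W (Phi f (f s)) = side W (Phi f (gen z ^ g)).
  move=> /pieceP[[s ->]|[s [t [st Vz zs zt]]]] nz; first by exists s.
  have good r : adj (gen z ^ g) (f r) -> ~~ cmt W (Phi f (f r)) ->
      side W (Phi f (f r)) = side W (Phi f (gen z ^ g)).
    move=> /andP[_ czr] nr; apply: side_cmt => //; try exact: isV_Phi.
    by rewrite cmt_sym; exact: cmt_Phi.
  have [cs|ns] := boolP (cmt W (Phi f (f s))); last by exists s => //; exact: good.
  have [ct|nt] := boolP (cmt W (Phi f (f t))); last by exists t => //; exact: good.
  exfalso; apply: (adj_square_free no_short (y := W) (z := Phi f (f s))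
    (y' := Phi f (gen z ^ g)) (z' := Phi f (f t))) => //; try exact: isV_Phi.
  - exact/eqP/notPhi.
  - by apply: contraNneq st => /Phi_inj/f_inj ->.
  - by rewrite /adj cs andbT; exact/eqP/notPhi.
  - by rewrite Phi_adj // adj_sym.
  - by rewrite Phi_adj.
  - by rewrite adj_sym /adj ct andbT; exact/eqP/notPhi.
have [a na sa] := rep x xp nX; have [b nb sb] := rep y yp nY.
have F_emb := Phi_embedding f_emb e_atomic.
have [|s [t [st cs ct]]] := cut_nbrs e_atomic F_emb na nb; first by rewrite /= sa sb.
have as_ : adj W (Phi f (f s)) by rewrite /adj cs andbT; exact/eqP/notPhi.
have at_ : adj W (Phi f (f t)) by rewrite /adj ct andbT; exact/eqP/notPhi.
(* By maximality the pair [s], [t] linked by [W] is already linked under [f], by some [w0]; then [W]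
   and [Phi f w0] are opposite corners of a square. *)
have /eqP links : linked f == linked (Phi f \o f).
  by rewrite eqEcard linked_Phi // f_max.
have : (s, t) \in linked f by rewrite links; apply/linkedP; split=> //; exists W.
case/linkedP=> _ [w0 [V0 w0s w0t]].
apply: (adj_square_free no_short (y := W) (z := Phi f (f s))
    (y' := Phi f w0) (z' := Phi f (f t))) => //; try exact: isV_Phi.
- exact/eqP/notPhi.
- by apply: contraNneq st => /Phi_inj/f_inj ->.
- by rewrite Phi_adj // adj_sym.
- by rewrite Phi_adj.
- by rewrite adj_sym.
Qed.

(** If [f z] is outside the chamber, the first wall [v] toward it serves. It is not [f y], since
    crossing [f y] would approach [f z] without moving away from [f z1]. It separates [f y] from
    [f z], hence links a pair by [cut_nbrs]. *)
Lemma path_end g x y z z1 : e x y -> e x z -> z != y -> e y z1 ->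
  chamber g (f x) -> chamber g (f y) ->
  (forall h, chamber h (f x) -> chamber h (f y) ->
     dst g (f z) + dst g (f z1) <= dst h (f z) + dst h (f z1)) ->
  exists a, [/\ hull (gen a ^ g), adj (gen a ^ g) (f x) & gen a ^ g <> f y].
Proof.
move=> exy exz zy eyz1 gx gy gmin.
have [/chamberP[a aE]|ngz] := boolP (chamber g (f z)).
  exists a; rewrite -aE; split; first by left; exists z.
    by rewrite f_adj sadj_sym.
  by move=> /f_inj zy'; rewrite zy' eqxx in zy.
have [u [b [nvz pos lt_d]]] := near_wall (Vf z) ngz.
set v := gen u ^ g in nvz pos *; have Vv : isV v by exact: isV_gen.
have cxz : cmt (f x) (f z) by move: exz; rewrite -f_adj => /andP[].
have vx : v != f x by apply: contraNneq nvz => ->.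
have vy : v != f y.
  apply/eqP => vyE; have cvx : cmt v (f x).
    by rewrite vyE cmt_sym; move: exy; rewrite -f_adj => /andP[].
  have cvy : cmt v (f y) by rewrite vyE cmtxx.
  have := gmin (ltr (u, b) * g) (chamber_ltr b cvx gx) (chamber_ltr b cvy gy).
  rewrite leqNgt -addSn leq_add // dst_cmt // -/v vyE.
  by move: eyz1; rewrite -f_adj => /andP[].
have sep r : ~~ cmt v (f r) -> side v (f r) = cr v g -> side v (f r) <> side v (f z).
  by move=> nr sr E; move: pos; rewrite -E sr subrr mulr0 ltxx.
have cvx : cmt v (f x).
  apply/negPn/negP => nvx; apply: (sep x nvx (side_cr gx nvx)).
  exact: side_cmt.
have avx : adj v (f x) by rewrite /adj vx.
have nvy : ~~ cmt v (f y).
  apply/negP => cvy; apply: (adj_triangle_free no_short Vv (Vf x) (Vf y)) => //.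
    by rewrite f_adj.
  by rewrite adj_sym /adj vy.
have neq := sep y nvy (side_cr gy nvy).
have [s [t [st cs ct]]] := cut_nbrs e_atomic f_emb nvy nvz neq.
have notf r : v != f r by apply/eqP; exact: cut_notin neq r.
exists u; split=> //; last exact/eqP.
by right; exists s, t; rewrite /adj !notf.
Qed.

Lemma other_nbr x y : e x y -> exists2 z, e x z & z != y.
Proof.
have [_ e_val _ _] := e_atomic => exy.
have /card_gt1P [c [d [ac ad neq_cd]]] : 1 < #|[set c | e x c]|.
  by rewrite ltn_neqAle eq_sym e_val; apply/card_gt0P; exists y; rewrite inE.
rewrite !inE in ac ad; case: (eqVneq c y) => [cy|]; last by exists c.
by exists d => //; rewrite -cy eq_sym.
Qed.

(** The middle edge is the image of the edge from [x] to [y]; [path_end] supplies both ends in one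
    chamber minimising the total distance to the two outer neighbours. *)
Lemma ex_path4 x y : e x y -> exists g, path4 (piece g).
Proof.
move=> exy; have eyx : e y x by rewrite sadj_sym.
have [z xz zy] := other_nbr exy; have [z1 yz1 z1x] := other_nbr eyx.
pose P n := exists g, [/\ chamber g (f x), chamber g (f y) &
  dst g (f z) + dst g (f z1) = n].
have [g [gx gy gn]] : P (leastn P).
  have cxy : cmt (f x) (f y) by move: exy; rewrite -f_adj => /andP[].
  have [g [gx gy]] := cmt_chamber (Vf x) (Vf y) cxy.
  by apply: leastnP; exists (dst g (f z) + dst g (f z1)), g.
have gmin h : chamber h (f x) -> chamber h (f y) ->
    dst g (f z) + dst g (f z1) <= dst h (f z) + dst h (f z1).
  by move=> hx hy; rewrite gn; apply: leastn_le; exists h.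
have [a [ha ax nay]] := path_end exy xz zy yz1 gx gy gmin.
have [|b [hb by_ nbx]] := path_end eyx yz1 z1x xz gy gx.
  by move=> h hy hx; rewrite ![_ + dst _ (f z)]addnC; exact: gmin.
exists g; case/chamberP: gx => x' xE; case/chamberP: gy => y' yE.
exists a, x', y', b; split.
- apply/subsetP => c; rewrite !inE -!orbA => /or4P[] /eqP ->; apply/asboolP => //; left.
    by exists x.
  by exists y.
- by apply: (@adj_type _ _ _ _ g g); rewrite -xE.
- by apply: (@adj_type _ _ _ _ g g); rewrite -xE -yE f_adj.
- by apply: (@adj_type _ _ _ _ g g); rewrite -yE adj_sym.
- apply/andP; split; apply/eqP => E; first by apply: nay; rewrite yE E.
  by apply: nbx; rewrite xE E.
Qed.

Lemma maximal_standard x y : e x y -> exists g, forall z, chamber g (f z).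
Proof.
move=> /ex_path4 [g0 p0].
pose P n := `[< exists2 g, path4 (piece g) & #|piece g| = n >].
have exP : exists n, P n by exists #|piece g0|; apply/asboolP; exists g0.
have leP n : P n -> n <= #|T| by move=> /asboolP[g _ <-]; apply: max_card.
case: (ex_maxnP exP leP) => n /asboolP[g pg gn] gmax.
have [||g' g'P] := @uncut_chamber _ e T (piece g) f.
- by move=> i _; exact: Vf.
- by move=> v i j Vv ip jp; exact: (piece_uncut Vv ip jp).
have [q qP] : exists q : T -> T, forall z, z \in piece g -> f z = gen (q z) ^ g'.
  have /fin_all_exists [q qP] z : exists u, z \in piece g -> f z = gen u ^ g'.
    have [zp|_] := boolP (z \in piece g); last by exists z.
    by have /chamberP[u uE] := g'P z zp; exists u.
  by exists q.
have q_inj : {in piece g &, injective q}.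
  by move=> a b ap bp qab; apply: f_inj; rewrite !qP // qab.
have q_core z : z \in piece g -> q z \in core g'.
  by move=> zp; apply/coreP; exists z; rewrite qP.
have q_adj a b : a \in piece g -> b \in piece g -> e a b -> e (q a) (q b).
  move=> ap bp; rewrite -f_adj !qP //; exact: adj_type.
have core4 : path4 (core g').
  case: pg => a [b [c [d [/subsetP sub ab bc cd /andP[ac bd]]]]].
  have [ap bp cp dp] : [/\ a \in piece g, b \in piece g, c \in piece g & d \in piece g].
    by split; apply: sub; rewrite !inE eqxx ?orbT.
  exists (q a), (q b), (q c), (q d); split; rewrite ?q_adj //.
    apply/subsetP => z; rewrite !in_setU !in_set1 -!orbA.
    by case/or4P=> /eqP ->; exact: q_core.
  by rewrite !(inj_in_eq q_inj) // ac.
(* The largest piece injects into [core g'], which lies in [piece g'], so all three have the same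
   size. *)
have coreE : core g' = piece g'.
  apply/eqP; rewrite eqEcard core_piece /=.
  have p' : path4 (piece g').
    case: core4 => a [b [c [d [sub ab bc cd acbd]]]]; exists a, b, c, d; split=> //.
    exact: subset_trans sub (core_piece g').
  apply: (@leq_trans #|piece g|).
    by rewrite gn; apply: gmax; apply/asboolP; exists g'.
  rewrite -(card_in_imset q_inj); apply/subset_leq_card/subsetP => _ /imsetP[z zp ->].
  exact: q_core.
exists g' => z; apply: contraT => /(near_wall (Vf z)) [u [b [nvz pos _]]].
set v := gen u ^ g' in nvz pos; have Vv : isV v by exact: isV_gen.
(* The path in the core does not fit into the star of [v]. *)
have [s [gs ns]] : exists s, chamber g' (f s) /\ ~~ cmt v (f s).
  case: core4 => a [b' [c [d [/subsetP sub ab bc cd /andP[ac bd]]]]].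
  apply: contrapT => no.
  have cv i : i \in core g' -> cmt v (gen i ^ g').
    move=> /coreP[s sE]; apply: contraT => ni; case: no; exists s.
    by rewrite -sE chamber_gen.
  have [ap bp cp dp] :
      [/\ a \in core g', b' \in core g', c \in core g' & d \in core g'].
    by split; apply: sub; rewrite !inE eqxx ?orbT.
  have [_] := no_short; have [tri _] := no_short.
  have ev i : i \in core g' -> i = u \/ e u i.
    move=> /cv; rewrite /v cmtJ cmt_gen => /orP[/eqP->|]; [by left|by right].
  move=> _; case: (ev b' bp) => [bu|eub].
    case: (ev d dp) => [du|eud]; first by rewrite bu du eqxx in bd.
    by apply: (tri b' c d); split=> //; rewrite bu sadj_sym.
  case: (ev c cp) => [cu|euc]; last first.
    by apply: (tri u b' c); split=> //; rewrite sadj_sym.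
  case: (ev a ap) => [au|eua]; first by rewrite au cu eqxx in ac.
  by apply: (tri u a b'); split=> //; rewrite sadj_sym.
have neq : side v (f s) <> side v (f z).
  by rewrite (side_cr gs ns) => E; move: pos; rewrite E subrr mulr0 ltxx.
have [s1 [t1 [st cs ct]]] := cut_nbrs e_atomic f_emb ns nvz neq.
have notf r : v != f r by apply/eqP; exact: cut_notin neq r.
(* The cutting vertex [v] links a pair, so [u] is in [piece g'], that is in [core g']; this puts [v]
   in the image, against [cut_notin]. *)
have : u \in core g'.
  by rewrite coreE; apply/pieceP; right; exists s1, t1; rewrite /adj !notf.
by case/coreP=> r /eqP; rewrite -/v (negPf (notf r)).
Qed.

End Maximal.

(** Pairs at distance two: every embedding links them, and an embedding into one chamber links no
    others. *)
Definition linked0 : {set T * T} :=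
  [set p | (p.1 != p.2) && [exists c, e c p.1 && e c p.2]].

Lemma linked0_sub f : embedding f -> linked0 \subset linked f.
Proof.
move=> f_emb; have [Vf _ _] := f_emb.
apply/subsetP => -[s t]; rewrite inE /= => /andP[st /existsP[c /andP[cs ct]]].
by apply/linkedP; split=> //; exists (f c); rewrite !(embedding_adj _ _ e_irr f_emb).
Qed.

Lemma linked_standard f g : embedding f -> (forall x, chamber g (f x)) ->
  linked f \subset linked0.
Proof.
move=> f_emb /(embedding_perm f_emb) [a [aP a_aut]].
apply/subsetP => -[s t] /linkedP[st [w [/isVP[c [h ->]]]]].
rewrite !aP => /adj_type cs /adj_type ct; rewrite inE st /=.
by apply/existsP; exists (a^-1 c); rewrite -(a_aut _ s) -(a_aut _ t) permKV cs.
Qed.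

Theorem embedding_standard f : embedding f -> exists g, forall x, chamber g (f x).
Proof.
move=> f_emb; have [Vf f_inj f_cmt] := f_emb.
suff uncut v x y : isV v -> ~~ cmt v (f x) -> ~~ cmt v (f y) ->
    side v (f x) = side v (f y).
  have [i _|v i j Vv _ _|g gP] := @uncut_chamber _ e T setT f.
  - exact: Vf.
  - exact: uncut.
  - by exists g => x; apply: gP; rewrite inE.
(* A connected graph without edges has at most one vertex. *)
move=> Vv nx ny; have [[a [b eab]]|no_edge] := pselect (exists a b, e a b); last first.
  suff -> : x = y by [].
  have [/(_ x y) xy _ _ _] := e_atomic.
  by apply: (connect_const (F := id) _ xy) => a b eab; case: no_edge; exists a, b.
pose P n := `[< exists2 f', embedding f' & #|linked f'| = n >].
have exP : exists n, P n by exists #|linked f|; apply/asboolP; exists f.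
have leP n : P n -> n <= #|{: T * T}| by move=> /asboolP[f' _ <-]; apply: max_card.
case: (ex_maxnP exP leP) => n /asboolP[f' f'_emb f'n] f'max.
have f'_max (h : T -> G) : embedding h -> #|linked h| <= #|linked f'|.
  by move=> h_emb; rewrite f'n; apply: f'max; apply/asboolP; exists h.
have [g gP] := maximal_standard f'_emb f'_max eab.
(* A maximal embedding is standard and links only [linked0], which bounds the number of pairs that
   [f] links. So a cutting vertex would be a common neighbour besides [f c], giving a square. *)
have /eqP links : linked0 == linked f.
  rewrite eqEcard linked0_sub // (leq_trans (f'_max f f_emb)) //.
  exact/subset_leq_card/(linked_standard f'_emb gP).
apply: contrapT => neq; have [s [t [st cs ct]]] := cut_nbrs e_atomic f_emb nx ny neq.
have notf r : v != f r by apply/eqP; exact: cut_notin neq r.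
have vs : adj v (f s) by rewrite /adj notf. have vt : adj v (f t) by rewrite /adj notf.
have : (s, t) \in linked0 by rewrite links; apply/linkedP; split=> //; exists v.
rewrite inE st /= => /existsP[c /andP[ecs ect]].
apply: (adj_square_free no_short (y := v) (z := f s) (y' := f c) (z' := f t)) => //.
- by rewrite (inj_eq f_inj).
- by rewrite (embedding_adj _ _ e_irr f_emb) sadj_sym.
- by rewrite (embedding_adj _ _ e_irr f_emb).
- by rewrite adj_sym.
Qed.

End Rigidity.

(** * Translation back to words *)

Theorem mainTheorem6 (T : finType) (e : rel T) (Hsimple : simple_graph e)
  (Hatomic : atomic e) (phi : T -> word T) (Hphi : induced_embedding e phi) :
  exists (g : word T) (a : {perm T}),
    graph_aut e a /\ forall v : T, raag_eq e (phi (a v)) (conj_gen g v).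
Proof.
have [e_sym e_irr] := Hsimple; have [phi_ext phi_inj phi_adj] := Hphi.
pose E := SGraph e_sym; pose f x := cls E (phi x).
have f_emb : embedding f.
  have f_inj : injective f by move=> x y /cls_eqP/phi_inj.
  split=> // [x|x y].
    have [g [u /(cls_eqP E) gE]] := phi_ext x.
    by rewrite /f gE cls_conj_gen; exact: isV_gen.
  have cP : cmt (f x) (f y) <-> commute_in e (phi x) (phi y).
    by rewrite /commute_in -(cls_eqP E) !clsM; split=> [/eqP|/eqP].
  case: eqP => [->|neq] /=; first exact: cmtxx.
  apply/idP/idP => [/cP c|/phi_adj[_ /cP//]].
  by apply/phi_adj; split=> // /phi_inj.
have [g gP] := embedding_standard (e := E) e_irr Hatomic f_emb.
have [a [aP a_aut]] := embedding_perm (e := E) e_irr f_emb gP.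
(* Since [f x] is [gen (a x) ^ g], precomposing with [a^-1] removes the relabelling. *)
exists (wrd g), a^-1; split=> [u v|v].
  by have := a_aut (a^-1 u) (a^-1 v); rewrite !permKV => /esym.
by apply/(cls_eqP E); rewrite cls_conj_gen wrdK -[cls E _]/(f _) aP permKV.
Qed.
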